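(* Suppose $f:\mathbb{R}^p\to\mathbb{R}$ has a finite minimum $f_\star$. Consider the linear time-invariant system $$\xi_{k+1}=A\xi_k+Bw_k,\qquad k=0,1,2,\dots,$$ with $A\in\mathbb{R}^{n_\xi\times n_\xi}$, $B\in\mathbb{R}^{n_\xi\times n_w}$, and a supply rate $S:\mathbb{R}^{n_\xi}\times\mathbb{R}^{n_w}\to\mathbb{R}$ satisfying $$S(\xi_k,w_k)\le-(f(z_k)-f_\star)\quad\text{for all }k$$ for some sequence $\{z_k\}$ in $\mathbb{R}^p$. If there exists a nonnegative storage function $V:\mathbb{R}^{n_\xi}\to\mathbb{R}_+$ such that the dissipation inequality $$V(\xi_{k+1})-V(\xi_k)\le S(\xi_k,w_k)\quad\text{for all }k$$ holds over all trajectories $(\xi_k,w_k)$, then over all trajectories and for every integer $T\ge 0$, $$\sum_{k=0}^{T}(f(z_k)-f_\star)\le V(\xi_0).$$ In addition, one has the sublinear convergence rate $$\min_{k:\,0\le k\le T}(f(z_k)-f_\star)\le\frac{V(\xi_0)}{T+1}.$$ If moreover $f(z_{k+1})\le f(z_k)$ for all $k$, then $f(z_k)-f_\star\le\frac{V(\xi_0)}{k+1}$ for all $k$.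
   Context: A trajectory is a pair of sequences $(\xi_k)_{k\ge0}$, $(w_k)_{k\ge0}$ satisfying the system recursion, where the inputs $w_k$ are those generated by whatever rule (e.g. an optimization algorithm's gradient feedback) drives the system. The sequence $\{z_k\}$ is associated with the trajectory (it may depend on it; e.g. $z_k$ is the iterate of the algorithm). $\mathbb{R}_+$ denotes the nonnegative reals. *)

(* Defs.v *)
(* R^n is the type 'cV[R]_n of column vectors over an arbitrary realType R. *)
From mathcomp Require Import all_boot all_order all_algebra.
From mathcomp Require Import reals.

Set Implicit Arguments.
Unset Strict Implicit.
Unset Printing Implicit Defensive.

Import Order.TTheory GRing.Theory Num.Theory.
Local Open Scope ring_scope.

Definition is_minimum (R : realType) (T : Type) (f : T -> R) (m : R) : Prop :=
  (exists x, f x = m) /\ (forall x, m <= f x).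

(* [rule xi w] says that the inputs [w] are generated, along the states [xi], by
   whatever mechanism drives the system (e.g. the gradient feedback of an
   algorithm).  The always-true rule gives the open-loop system, whose inputs
   are unrestricted. *)
Definition is_trajectory (R : realType) (n m : nat)
    (A : 'M[R]_n) (B : 'M[R]_(n, m))
    (rule : (nat -> 'cV[R]_n) -> (nat -> 'cV[R]_m) -> Prop)
    (xi : nat -> 'cV[R]_n) (w : nat -> 'cV[R]_m) : Prop :=
  (forall k : nat, xi k.+1 = A *m xi k + B *m w k) /\ rule xi w.

(* Main.v *)
Require Import Defs.
From mathcomp Require Import all_boot all_order all_algebra.
From mathcomp Require Import reals.

Set Implicit Arguments.
Unset Strict Implicit.
Unset Printing Implicit Defensive.

Import Order.TTheory GRing.Theory Num.Theory.
Local Open Scope ring_scope.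

(** Each step of a trajectory pays for the suboptimality at that step out of
    the stored energy: chaining the dissipation inequality with the bound on
    the supply rate gives f(z_k) - f_star <= V(xi_k) - V(xi_{k+1}).  The right-hand
    side telescopes, and since V is nonnegative the total that can be paid up to
    any time is at most the initial energy V(xi_0) ([sum_le_storage]).

    The two rates are averaging statements: a number that lies below each of
    T + 1 terms lies below their mean ([le_mean]).  The minimum of the gaps is
    such a number, and when f(z_k) is nonincreasing, so is the last gap. *)

(** The sum is bounded by v 0 - v n by telescoping; nonnegativity of the final
    storage removes the dependence on n. *)
Lemma sum_le_storage (R : numDomainType) (d v : nat -> R) (n : nat) :
    (forall k, 0 <= v k) -> (forall k, d k <= v k - v k.+1) ->
  \sum_(0 <= k < n) d k <= v 0%N.
Proof.
move=> v_ge0 d_le; apply: (@le_trans _ _ (v 0%N - v n)); last first.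
  by rewrite gerBl.
rewrite -opprB -(telescope_sumr _ (leq0n n)) -sumrN.
by apply: ler_sum => k _; rewrite opprB.
Qed.

Lemma le_mean (R : numFieldType) (d : nat -> R) (T : nat) (c M : R) :
    (forall k, (k <= T)%N -> c <= d k) -> \sum_(0 <= k < T.+1) d k <= M ->
  c <= M / T.+1%:R.
Proof.
move=> c_le sum_le; rewrite ler_pdivlMr ?ltr0n // mulr_natr.
apply: le_trans sum_le; rewrite -[T.+1 in leLHS]subn0 -sumr_const_nat.
by apply: ler_sum_nat => k /andP[_ kT]; apply: c_le.
Qed.

Theorem theorem7 (R : realType) (p nxi nw : nat)
    (f : 'cV[R]_p -> R) (fstar : R) (hf : is_minimum f fstar)
    (A : 'M[R]_nxi) (B : 'M[R]_(nxi, nw))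
    (rule : (nat -> 'cV[R]_nxi) -> (nat -> 'cV[R]_nw) -> Prop)
    (S : 'cV[R]_nxi -> 'cV[R]_nw -> R)
    (z : (nat -> 'cV[R]_nxi) -> (nat -> 'cV[R]_nw) -> nat -> 'cV[R]_p)
    (hS : forall xi w, is_trajectory A B rule xi w ->
       forall k : nat, S (xi k) (w k) <= - (f (z xi w k) - fstar))
    (V : 'cV[R]_nxi -> R) (hV : forall x, 0 <= V x)
    (hdiss : forall xi w, is_trajectory A B rule xi w ->
       forall k : nat, V (xi k.+1) - V (xi k) <= S (xi k) (w k)) :
  forall xi w, is_trajectory A B rule xi w ->
    [/\ forall T : nat,
          \sum_(0 <= k < T.+1) (f (z xi w k) - fstar) <= V (xi 0%N),
        forall T : nat,
          \big[Num.min/f (z xi w 0%N) - fstar]_(0 <= k < T.+1)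
              (f (z xi w k) - fstar) <= V (xi 0%N) / T.+1%:R
      & (forall k : nat, f (z xi w k.+1) <= f (z xi w k)) ->
        forall k : nat, f (z xi w k) - fstar <= V (xi 0%N) / k.+1%:R].
Proof.
move=> xi w traj; pose gap k := f (z xi w k) - fstar.
have gap_le k : gap k <= V (xi k) - V (xi k.+1).
  by rewrite -[gap k]opprK lerNl opprB (le_trans (hdiss _ _ traj k)) ?hS.
have sum_gap T : \sum_(0 <= k < T.+1) gap k <= V (xi 0%N).
  by apply: (@sum_le_storage _ gap (fun k => V (xi k))).
split=> [//|T|f_dec T]; apply: le_mean (sum_gap T) => k kT.
  by apply: (@bigmin_inf_seq _ _ _ _ _ k); rewrite ?mem_index_iota.
rewrite lerD2r; exact: (Order.NatMonotonyTheory.nonincnP (f := fun k => f (z xi w k))).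
Qed.
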